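(* Let $P,Q\in\mathbb{H}[q_1,q_2]$ and let $\langle P,Q\rangle=\{P*R+Q*S: R,S\in\mathbb{H}[q_1,q_2]\}$ be the right ideal they generate. Then the regular resultant ${\rm Res}(P,Q;q_1)$ belongs to $\langle P,Q\rangle\cap\mathbb{H}[q_2]$, and the regular resultant ${\rm Res}(P,Q;q_2)$ belongs to $\langle P,Q\rangle\cap\mathbb{H}[q_1]$.
   Context: $\mathbb{H}$ denotes the quaternions. A slice regular polynomial in two quaternionic variables is a function $\mathbb{H}^2\to\mathbb{H}$ of the form $P(q_1,q_2)=\sum_{n=0}^{N}\sum_{m=0}^{M}q_1^nq_2^ma_{n,m}$ with $a_{n,m}\in\mathbb{H}$ (coefficients on the right); $\deg_{q_1}P$, $\deg_{q_2}P$ are the degrees in $q_1$, $q_2$. The set of these is $\mathbb{H}[q_1,q_2]$, and $\mathbb{H}[q]$ denotes the analogous one-variable polynomials $\sum q^na_n$ (so $\mathbb{H}[q_1],\mathbb{H}[q_2]\subset\mathbb{H}[q_1,q_2]$). The $*$-product is defined by $\big(\sum q_1^nq_2^ma_{n,m}\big)*\big(\sum q_1^nq_2^mb_{n,m}\big)=\sum_{n,m}q_1^nq_2^m\sum_{r\le n,s\le m}a_{r,s}b_{n-r,m-s}$ (and analogously in one variable); $(\mathbb{H}[q],+,* )$ is a left and right Ore domain and we let $\mathcal{L}$ be its skew field of quotients. Every $P\in\mathbb{H}[q_1,q_2]$ can be written as $P=\sum_{k=0}^{n}q_1^kP_k(q_2)$ with $P_k\in\mathbb{H}[q_2]$, and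 as $P=\sum_{k=0}^{r}q_2^k*\tilde P_k(q_1)$ with $\tilde P_k\in\mathbb{H}[q_1]$. Dieudonné determinant: for a skew field $(\mathbb F,+,\star)$, let $\overline{\mathbb F}^\star$ be the abelianization of its multiplicative group; ${\rm Det}^\star_N$ is the unique homomorphism $GL(N,\mathbb F)\to\overline{\mathbb F}^\star$ sending ${\rm diag}(\lambda_1,\dots,\lambda_N)$ to the class of $\lambda_1\star\cdots\star\lambda_N$, extended by the value $[0]$ on non-invertible matrices. Here ${\rm Det}^*_N$ is this determinant over $\mathcal L$; for a matrix with entries in $\mathbb{H}[q]$ its value has a slice regular polynomial representative, unique up to commutators, with which it is identified. Regular resultants: let $P=\sum_{k=0}^nq_1^kP_k(q_2)$, $Q=\sum_{k=0}^mq_1^kQ_k(q_2)$. The Sylvester matrix $A(q_2)$ is the $(n+m)\times(n+m)$ matrix whose $j$-th column ($1\le j\le m$) has entries $P_0,\dots,P_n$ in rows $j,\dots,j+n$ and zeros elsewhere, and whose $(m+j)$-th column ($1\le j\le n$) has entries $Q_0,\dots,Q_m$ in rows $j,\dots,j+m$ and zeros elsewhere; ${\rm Res}(P,Q;q_1):={\rm Det}^*_{n+m}(A(q_2))$. Likewise, with $P=\sum_{k=0}^rq_2^k*\tilde P_k(q_1)$, $Q=\sum_{k=0}^sq_2^k*\tilde Q_k(q_1)$, $B(q_1)$ is the $(r+s)\times(r+s)$ matrix built in the same way from $\tilde P_0,\dots,\tilde P_r$ (first $s$ columns) and $\tilde Q_0,\dots,\tilde Q_s$ (last $r$ columns), and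 ${\rm Res}(P,Q;q_2):={\rm Det}^*_{r+s}(B(q_1))$.
   Formalization: Each claim assumes that P and Q do not both have degree 0 in the eliminated variable: otherwise the Sylvester matrix is 0×0 with determinant 1, and e.g. P = Q = q2 gives 1 not in ⟨P,Q⟩. The resultant is read as having some polynomial representative in the ideal. *)

(* Defs.v *)
From HB Require Import structures.
From mathcomp Require Import all_boot all_order all_algebra.
From mathcomp Require Import reals.
From mathcomp Require Import ring.
Set Implicit Arguments.
Unset Strict Implicit.
Unset Printing Implicit Defensive.
Import Order.TTheory GRing.Theory Num.Theory.
Local Open Scope ring_scope.

Record quat (K : Type) := Quat { qre : K; qi : K; qj : K; qk : K }.
Arguments Quat {K}.

Section Quaternions.
Variable K : fieldType.

Definition quat2tuple (x : quat K) := (qre x, qi x, qj x, qk x).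
Definition tuple2quat (t : K * K * K * K) :=
  let: (a, b, c, d) := t in Quat a b c d.
Lemma quat2tupleK : cancel quat2tuple tuple2quat. Proof. by case. Qed.

HB.instance Definition _ := Equality.copy (quat K) (can_type quat2tupleK).
HB.instance Definition _ := Choice.copy (quat K) (can_type quat2tupleK).

Definition qzero := Quat (0 : K) 0 0 0.
Definition qone := Quat (1 : K) 0 0 0.
Definition qopp (x : quat K) := Quat (- qre x) (- qi x) (- qj x) (- qk x).
Definition qadd (x y : quat K) :=
  Quat (qre x + qre y) (qi x + qi y) (qj x + qj y) (qk x + qk y).
(* Hamilton product: i^2 = j^2 = k^2 = ijk = -1 *)
Definition qmul (x y : quat K) :=
  let: Quat a0 a1 a2 a3 := x in let: Quat b0 b1 b2 b3 := y in
  Quat (a0 * b0 - a1 * b1 - a2 * b2 - a3 * b3)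
       (a0 * b1 + a1 * b0 + a2 * b3 - a3 * b2)
       (a0 * b2 - a1 * b3 + a2 * b0 + a3 * b1)
       (a0 * b3 + a1 * b2 - a2 * b1 + a3 * b0).
Definition qnorm (x : quat K) :=
  qre x ^+ 2 + qi x ^+ 2 + qj x ^+ 2 + qk x ^+ 2.
Definition qunit : pred (quat K) := fun x => qnorm x != 0.
Definition qinv (x : quat K) :=
  if qnorm x == 0 then x else
  let n := (qnorm x)^-1 in Quat (qre x * n) (- qi x * n) (- qj x * n) (- qk x * n).

Lemma qaddA : associative qadd.
Proof. by case=> ????[????][????]; rewrite /qadd /= !addrA. Qed.
Lemma qaddC : commutative qadd.
Proof. by case=> ????[????]; rewrite /qadd /=; congr Quat; apply: addrC. Qed.
Lemma qadd0 : left_id qzero qadd.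
Proof. by case=> ????; rewrite /qadd /= !add0r. Qed.
Lemma qaddN : left_inverse qzero qopp qadd.
Proof. by case=> ????; rewrite /qadd /= !addNr. Qed.

HB.instance Definition _ := GRing.isZmodule.Build (quat K) qaddA qaddC qadd0 qaddN.

Lemma qmulA : associative qmul.
Proof. case=> ????[????][????]; rewrite /qmul /=; congr Quat; ring. Qed.
Lemma qmul1 : left_id qone qmul.
Proof. case=> ????; rewrite /qmul /=; congr Quat; ring. Qed.
Lemma qmulr1 : right_id qone qmul.
Proof. case=> ????; rewrite /qmul /=; congr Quat; ring. Qed.
Lemma qmulDl : left_distributive qmul qadd.
Proof. case=> ????[????][????]; rewrite /qmul /= /qadd /=; congr Quat; ring. Qed.
Lemma qmulDr : right_distributive qmul qadd.
Proof. case=> ????[????][????]; rewrite /qmul /= /qadd /=; congr Quat; ring. Qed.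
Lemma qone_neq0 : qone != 0.
Proof. by apply/eqP=> -[] /eqP; rewrite oner_eq0. Qed.

HB.instance Definition _ := GRing.Zmodule_isNzRing.Build (quat K)
  qmulA qmul1 qmulr1 qmulDl qmulDr qone_neq0.

Lemma qnormM (x y : quat K) : qnorm (x * y) = qnorm x * qnorm y.
Proof. case: x y => ????[????]; rewrite /qnorm /= /qmul /=; ring. Qed.

Lemma qmulV : {in qunit, left_inverse 1 qinv *%R}.
Proof.
case=> a b c d; rewrite unfold_in /qunit /= => nz; rewrite /qinv (negPf nz).
move: nz; rewrite /qnorm /= => nz.
rewrite -[LHS]/(qmul _ _) /qmul /=; rewrite -[RHS]/(Quat 1 0 0 0); congr Quat; field; exact: nz.
Qed.
Lemma qdivrr : {in qunit, right_inverse 1 qinv *%R}.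
Proof.
case=> a b c d; rewrite unfold_in /qunit /= => nz; rewrite /qinv (negPf nz).
move: nz; rewrite /qnorm /= => nz.
rewrite -[LHS]/(qmul _ _) /qmul /=; rewrite -[RHS]/(Quat 1 0 0 0); congr Quat; field; exact: nz.
Qed.
Lemma qunitP (x y : quat K) : y * x = 1 /\ x * y = 1 -> qunit x.
Proof.
move=> [_ h]; have := congr1 qnorm h; rewrite qnormM.
have -> : qnorm (1 : quat K) = 1.
  by rewrite /qnorm -[1]/(Quat 1 0 0 0) /= expr1n expr0n /= !addr0.
move=> h1; rewrite /qunit; apply/eqP=> x0; move: h1; rewrite x0 mul0r.
by move/eqP; rewrite eq_sym oner_eq0.
Qed.
Lemma qinv_out : {in [predC qunit], qinv =1 id}.
Proof. by move=> x; rewrite inE /= /qunit /qinv negbK => ->. Qed.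

HB.instance Definition _ := GRing.NzRing_hasMulInverse.Build (quat K)
  qmulV qdivrr qunitP qinv_out.

End Quaternions.

(* Dieudonne determinant over a skew field L (here: any unit ring; it  *)
(* is applied below to the skew field of quotients of H[q]).           *)
Section Dieudonne.
Variable L : unitRingType.

Inductive commsub : L -> Prop :=
| commsub1 : commsub 1
| commsubM c a b : commsub c -> a \is a GRing.unit -> b \is a GRing.unit ->
    commsub (c * (a * b * a^-1 * b^-1)).

(* Equality of classes in  the abelianization of L^x  extended by the class [0] of 0. *)
Definition dclass_eq (x y : L) : Prop :=
  (x = 0 /\ y = 0) \/
  [/\ x \is a GRing.unit, y \is a GRing.unit & commsub (x * y^-1)].

Definition mx_invertible N (A : 'M[L]_N) : Prop :=
  exists B : 'M[L]_N, A *m B = 1%:M /\ B *m A = 1%:M.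

(* d : 'M_N -> L, read modulo commutators, is the Dieudonne determinant: *)
(* a homomorphism GL(N,L) -> the abelianization of L^x sending diag(l_1..l_N) to the      *)
(* class of l_1 * ... * l_N, and taking the value [0] on singular matrices.*)
Definition is_dieudonne_det N (d : 'M[L]_N -> L) : Prop :=
  [/\ forall A, ~ mx_invertible A -> d A = 0,
      forall A, mx_invertible A -> d A \is a GRing.unit,
      forall A B, mx_invertible A -> mx_invertible B ->
        dclass_eq (d (A *m B)) (d A * d B)
    & forall lam : 'rV[L]_N, (forall i, lam 0 i \is a GRing.unit) ->
        dclass_eq (d (diag_mx lam)) (\prod_(i < N) lam 0 i)].

(* "Det_N(A) = [x]" : the (unique) Dieudonne determinant of A is the class of x. *)
Definition dieudonne_det_is N (A : 'M[L]_N) (x : L) : Prop :=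
  forall d : 'M[L]_N -> L, is_dieudonne_det d -> dclass_eq (d A) x.

End Dieudonne.

(*   H[q]       = {poly quat R}  (the *-product is the polynomial product, *)
(*                the variable being central);                          *)
(*   H[q1,q2]   = {poly {poly quat R}} : outer variable q1, coefficients  *)
(*                P_k(q2) in H[q2], i.e. P = sum_k q1^k P_k(q2).          *)
Section SliceRegular.
Variable R : fieldType.

(* The skew field of quotients L of H[q] = (quat R)[t] is realized as the *)
(* quaternion algebra over R(t); iota_L is the canonical embedding.       *)
Definition Lquot := quat {fraction {poly R}}.

Definition iota_L (p : {poly quat R}) : Lquot :=
  Quat (tofrac (map_poly (@qre R) p)) (tofrac (map_poly (@qi R) p))
       (tofrac (map_poly (@qj R) p)) (tofrac (map_poly (@qk R) p)).

Definition degq1 (P : {poly {poly quat R}}) : nat := (size P).-1.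
Definition coef_size (P : {poly {poly quat R}}) (i : nat) : nat := size P`_i.
Definition degq2 (P : {poly {poly quat R}}) : nat :=
  (\max_(i < size P) coef_size P i)%N.-1.

(* P = sum_k q2^k * Ptilde_k(q1) *)
Definition ptilde (P : {poly {poly quat R}}) (k : nat) : {poly quat R} :=
  \poly_(i < size P) (P`_i)`_k.

Definition of_q2 (p : {poly quat R}) : {poly {poly quat R}} := p%:P.
Definition of_q1 (p : {poly quat R}) : {poly {poly quat R}} := map_poly polyC p.

Definition in_rideal (P Q F : {poly {poly quat R}}) : Prop :=
  exists Rr Ss : {poly {poly quat R}}, F = P * Rr + Q * Ss.

End SliceRegular.

Definition sylvester (T : nzRingType) (n m : nat) (a b : nat -> T)
  : 'M[T]_(n + m) :=
  \matrix_(i < n + m, j < n + m)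
    if (j < m)%N then (if (j <= i <= j + n)%N then a (i - j)%N else 0)
    else (if (j - m <= i <= j - m + m)%N then b (i - (j - m))%N else 0).

Definition sylv_q1 (R : fieldType) (P Q : {poly {poly quat R}}) :=
  sylvester (degq1 P) (degq1 Q) (fun k => P`_k) (fun k => Q`_k).

Definition sylv_q2 (R : fieldType) (P Q : {poly {poly quat R}}) :=
  sylvester (degq2 P) (degq2 Q) (ptilde P) (ptilde Q).

Definition det_repr (R : fieldType) N (A : 'M[{poly quat R}]_N)
  (p : {poly quat R}) : Prop :=
  dieudonne_det_is (map_mx (@iota_L R) A) (iota_L p).

(* Main.v *)
Require Import Defs.
From HB Require Import structures.
From mathcomp Require Import all_boot all_order all_algebra.
From mathcomp Require Import reals.
From mathcomp Require Import generic_quotient zify.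
From Stdlib Require Import Classical.
Set Implicit Arguments.
Unset Strict Implicit.
Unset Printing Implicit Defensive.
Import GRing.Theory Num.Theory.
Local Open Scope ring_scope.

(* H[q] is Euclidean, so column operations over H[q] (right multiplication by a
   product U of transvections) turn the Sylvester matrix A into an upper
   triangular T = A U with diagonal t_0, ..., t_(N-1). Transvections have trivial
   Dieudonne determinant, so p = t_0 * ... * t_(N-1) represents Det A when A is
   invertible over the skew field of quotients; otherwise p = 0 does. Since
   T e_0 = t_0 e_0, the vector v = U e_0 t_1 * ... * t_(N-1) satisfies A v = p e_0.
   Multiplying on the left by the row (1, z, z^2, ...) of powers of the eliminated
   variable z turns the columns of A into the z^j P and z^j Q, so p lies in the
   right ideal generated by P and Q. *)

(** * Transvections as column operations *)

Definition division_ring (D : unitRingType) :=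
  forall x : D, x != 0 -> x \is a GRing.unit.

Section Transvections.
Variables (T : nzRingType) (N : nat).
Implicit Types (M U : 'M[T]_N) (i j k l : 'I_N).

Definition transvection i j (c : T) : 'M[T]_N := 1%:M + c *: delta_mx i j.

Inductive transvection_product : 'M[T]_N -> Prop :=
| transvection_product1 : transvection_product 1%:M
| transvection_productM U i j c : i != j -> transvection_product U ->
    transvection_product (U *m transvection i j c).

Lemma mulmx_transvection M i j c k l :
  (M *m transvection i j c) k l = M k l + (M k i * c) *+ (l == j).
Proof.
rewrite mulmxDr mulmx1 !mxE (bigD1 i) //= big1 => [|x /negPf xi].
  by rewrite !mxE eqxx /= addr0 -!mulrnAr mulr_natr.
by rewrite !mxE xi mulr0 mulr0.
Qed.

Lemma transvectionD i j a b : i != j ->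
  transvection i j a *m transvection i j b = transvection i j (a + b).
Proof.
move=> ij; apply/matrixP=> k l; rewrite mulmx_transvection !mxE (negPf ij).
by rewrite andbF mulr0 addr0 mulrDl -addrA; do 2?congr (_ + _);
  case: (k == i); case: (l == j); rewrite /= ?mulr1 ?mulr0 ?mul1r ?mul0r.
Qed.

Lemma transvection0 i j : transvection i j 0 = 1%:M.
Proof. by rewrite /transvection scale0r addr0. Qed.

Lemma transvection_product_mul U V :
  transvection_product U -> transvection_product V ->
  transvection_product (U *m V).
Proof.
move=> pU; elim=> [|W i j c ij _ pW]; first by rewrite mulmx1.
by rewrite mulmxA; apply: transvection_productM.
Qed.

(** As [j] is not in [s], the columns listed in [s] stay fixed while their multiples are added to
    column [j], so the successive operations simply add up. *)
Lemma transvection_product_col (j : 'I_N) (c : 'I_N -> T) (s : seq 'I_N) :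
  j \notin s -> exists2 U, transvection_product U &
    forall M k l, (M *m U) k l = M k l + (\sum_(i <- s) M k i * c i) *+ (l == j).
Proof.
elim: s => [|i s IH].
  exists 1%:M; first by constructor.
  by move=> M k l; rewrite mulmx1 big_nil mul0rn addr0.
rewrite inE negb_or eq_sym => /andP[ij /IH[U pU UE]].
exists (U *m transvection i j (c i)); first exact: transvection_productM.
move=> M k l; rewrite mulmxA mulmx_transvection !UE (negPf ij) addr0 big_cons.
by rewrite -addrA -mulrnDl [X in X *+ _]addrC.
Qed.

Definition upper_triangular M := forall i j, (j < i)%N -> M i j = 0.

End Transvections.

Lemma map_transvection (T T' : nzRingType) (f : {rmorphism T -> T'}) N
    (i j : 'I_N) c :
  map_mx f (transvection i j c) = transvection i j (f c).
Proof. by rewrite map_mxD map_mx1 map_mxZ map_delta_mx. Qed.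

Lemma map_transvection_product (T T' : nzRingType) (f : {rmorphism T -> T'}) N
    (U : 'M[T]_N) :
  transvection_product U -> transvection_product (map_mx f U).
Proof.
elim=> [|V i j c ij _ IH]; first by rewrite map_mx1; constructor.
by rewrite map_mxM map_transvection; constructor.
Qed.

(** * Euclidean triangularization of polynomial matrices *)

Section Triangularization.
Variables (D : unitRingType) (divD : division_ring D).

Lemma poly_reduction (a b : {poly D}) : b != 0 -> (size b <= size a)%N ->
  exists c : {poly D}, (size (a + b * c)%R < size a)%N.
Proof.
move=> b0 ba; have a0 : (0 < size a)%N by apply: leq_trans ba; rewrite size_poly_gt0.
have ub : lead_coef b \is a GRing.unit by apply: divD; rewrite lead_coef_eq0.
(* This monomial cancels the leading term of [a]; it multiplies [b] on the right, as column
   operations do. *)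
exists (- (((lead_coef b)^-1 * lead_coef a)%:P * 'X^(size a - size b))).
rewrite -[ltnRHS](prednK a0) ltnS; apply/leq_sizeP=> j hj.
rewrite mulrN mulrA coefD coefN coefMXn coefMC.
have b1 : (0 < size b)%N by rewrite size_poly_gt0.
case: ltnP => [?|_]; first by exfalso; lia.
have [hj'|hj'] := leqP (size a) j.
  by rewrite (nth_default _ hj') nth_default ?mul0r ?subr0 // -{1}(subKn ba) leq_sub2r.
have -> : j = (size a).-1 by lia.
have -> : ((size a).-1 - (size a - size b) = (size b).-1)%N by lia.
by rewrite -!/(lead_coef _) mulVKr // subrr.
Qed.


(** Off-diagonal sizes count twice, so that moving an entry onto a vanishing diagonal entry also
    lowers the weight. *)
Definition row_weight N (M : 'M[{poly D}]_N) (i : 'I_N) :=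
  (\sum_(j < N | (j <= i)%N) size (M i j) * (1 + (j != i)))%N.

(** Euclid's algorithm on row [i], by induction on [row_weight]. Only columns up to [i] are touched;
    they vanish in the rows below [i], so the zeros already obtained there survive. *)
Lemma clear_row N (M : 'M[{poly D}]_N) (i : 'I_N) :
  (forall k j : 'I_N, (i < k)%N -> (j < k)%N -> M k j = 0) ->
  exists2 U, transvection_product U &
    forall k j : 'I_N, (i <= k)%N -> (j < k)%N -> (M *m U) k j = 0.
Proof.
have [s] := ubnP (row_weight M i).
elim: s M => // s IH M; rewrite ltnS => Ms M0.
have step V : transvection_product V ->
    (forall k j : 'I_N, (i < k)%N -> (j < k)%N -> (M *m V) k j = 0) ->
    (row_weight (M *m V) i < row_weight M i)%N ->
    exists2 U, transvection_product U &
      forall k j : 'I_N, (i <= k)%N -> (j < k)%N -> (M *m U) k j = 0.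
  move=> pV V0 lt_weight.
  have [||U pU UE] := IH (M *m V) => //; first exact: leq_trans Ms.
  exists (V *m U); last by rewrite mulmxA.
  exact: transvection_product_mul.
have reduce (j j' : 'I_N) c : (j <= i)%N -> (j' <= i)%N -> j' != j ->
    (size (M i j + M i j' * c)%R < size (M i j))%N ->
    exists2 U, transvection_product U &
      forall k j : 'I_N, (i <= k)%N -> (j < k)%N -> (M *m U) k j = 0.
  move=> ji j'i j'j lt_size; apply: (step (transvection j' j c)).
  - rewrite -[transvection _ _ _]mul1mx.
    by apply: transvection_productM => //; constructor.
  - move=> k l ik lk; rewrite mulmx_transvection !M0 ?mul0r ?mul0rn ?addr0 //.
    exact: leq_ltn_trans ik.
  rewrite /row_weight [X in (_ < X)%N](bigD1 j) //= (bigD1 j) //= -addSn.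
  rewrite mulmx_transvection eqxx leq_add //.
    by rewrite ltn_mul2r lt_size.
  apply: leq_sum => l /andP[_ /negPf lj].
  by rewrite mulmx_transvection lj addr0.
have [/existsP[j /andP[ji nz]]|no_nz] :=
    boolP [exists j : 'I_N, (j < i)%N && (M i j != 0)]; last first.
  exists 1%:M; first by constructor.
  move=> k j; rewrite mulmx1 leq_eqVlt => /orP[/eqP/val_inj<- ji|]; last exact: M0.
  apply/eqP; apply: contraNT no_nz => nz.
  by apply/existsP; exists j; rewrite ji.
have ij : i != j by rewrite neq_ltn ji orbT.
have ji' : j != i by rewrite eq_sym.
(* The longer of [M i i] and [M i j] is reduced by the shorter one, if the latter is nonzero. *)
have [le_ij|lt_ji] := leqP (size (M i i)) (size (M i j)); last first.
  have [c hc] := poly_reduction nz (ltnW lt_ji).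
  by apply: (reduce i j c (leqnn _) (ltnW ji)) => //; rewrite eq_sym.
have [Mii0|Mii] := eqVneq (M i i) 0; last first.
  have [c hc] := poly_reduction Mii le_ij.
  exact: (reduce j i c (ltnW ji) (leqnn _) ij hc).
(* The pivot vanishes: bring [M i j] to the diagonal by a signed swap. *)
apply: (step (transvection j i 1 *m transvection i j (-1))).
- apply: transvection_productM => //; rewrite -[transvection _ _ _]mul1mx.
  by apply: transvection_productM; [| constructor].
- move=> k l ik lk; rewrite mulmxA !mulmx_transvection !M0 //.
    by rewrite !mul0r !mul0rn !addr0 mul0r mul0rn !addr0.
  exact: (ltn_trans ji).
rewrite /row_weight (bigD1 i) // (bigD1 j) ?(ltnW ji) ?ji' //=.
rewrite [X in (_ < X)%N](bigD1 i) //
  [X in (_ < _ + X)%N](bigD1 j) ?(ltnW ji) ?ji' //=.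
rewrite mulmxA !mulmx_transvection Mii0 !eqxx (negPf ij) (negPf ji').
rewrite add0r !mulr1n !mulr0n !addr0 mulr1 mulrN1 subrr size_poly0 muln1 !mul0n !add0n.
rewrite -addSn leq_add //; first by rewrite muln2 -addnn -addn1 leq_add2l size_poly_gt0.
apply: leq_sum => l /andP[/andP[_ /negPf li] /negPf lj].
by rewrite !mulmx_transvection li lj !addr0.
Qed.

Lemma upper_triangularization N (M : 'M[{poly D}]_N) :
  exists2 U, transvection_product U & upper_triangular (M *m U).
Proof.
(* Rows are cleared from the bottom up; [k] counts the rows already done. *)
suff: forall k, (k <= N)%N -> exists2 U, transvection_product U &
    forall i j : 'I_N, (N <= i + k)%N -> (j < i)%N -> (M *m U) i j = 0.
  case/(_ N (leqnn _)) => U pU U0; exists U => // i j.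
  by apply: U0; rewrite leq_addl.
elim=> [|k IH] kN.
  exists 1%:M; first by constructor.
  by move=> i j; rewrite addn0 leqNgt ltn_ord.
have [U pU U0] := IH (ltnW kN).
have rN : (N - k.+1 < N)%N by rewrite ltn_subrL (leq_ltn_trans _ kN).
have [|V pV V0] := @clear_row N (M *m U) (Ordinal rN).
  by move=> i j /= ri; apply: U0; lia.
exists (U *m V); first exact: transvection_product_mul.
by move=> i j Ni; rewrite mulmxA; apply: V0; rewrite /=; lia.
Qed.
End Triangularization.

(** * Classes modulo commutators *)

Section DieudonneClasses.
Variable L : unitRingType.
Implicit Types a b c x y z : L.

Lemma commsub_mul c c' : commsub c -> commsub c' -> commsub (c * c').
Proof.
move=> cc; elim=> [|c1 a b _ IH ua ub]; first by rewrite mulr1.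
by rewrite mulrA; apply: commsubM.
Qed.

Lemma commsub_comm a b : a \is a GRing.unit -> b \is a GRing.unit ->
  commsub (a * b * a^-1 * b^-1).
Proof.
move=> ua ub; rewrite -[X in commsub X]mul1r.
by apply: commsubM => //; constructor.
Qed.

Lemma commsub_unit c : commsub c -> c \is a GRing.unit.
Proof. by elim=> [|c1 a b _ IH ua ub]; rewrite ?unitr1 // !unitrMl ?unitrV. Qed.

Lemma commsub_inv c : commsub c -> commsub c^-1.
Proof.
elim=> [|c1 a b pc IH ua ub]; first by rewrite invr1; constructor.
have uc := commsub_unit pc.
have -> : (c1 * (a * b * a^-1 * b^-1))^-1 = b * a * b^-1 * a^-1 * c1^-1.
  by rewrite !(invrM, invrK, mulrA, unitrMl, unitrV).
by apply: commsub_mul => //; apply: commsub_comm.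
Qed.

(** The conjugate is the commutator of [x] and [c] times [c]. This normality makes classes
    compatible with multiplication on the left. *)
Lemma commsub_conj x c : x \is a GRing.unit -> commsub c -> commsub (x * c * x^-1).
Proof.
move=> ux pc; have uc := commsub_unit pc.
rewrite -[X in commsub X](mulrVK uc).
by apply: commsub_mul => //; apply: commsub_comm.
Qed.

Lemma dclass_eq_refl x : x \is a GRing.unit -> dclass_eq x x.
Proof. by move=> ux; right; split=> //; rewrite divrr //; constructor. Qed.

Lemma dclass_eq_sym x y : dclass_eq x y -> dclass_eq y x.
Proof.
case=> [[-> ->]|[ux uy xy]]; first by left.
right; split=> //; rewrite -[y * _]invrK; apply: commsub_inv.
by rewrite invrM ?unitrV ?invrK.
Qed.

Lemma dclass_eq_trans y x z : dclass_eq x y -> dclass_eq y z -> dclass_eq x z.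
Proof.
case=> [[-> ->]|[ux uy xy]] [[y0 z0]|[uy' uz yz]].
- by left.
- by rewrite unitr0 in uy'.
- by rewrite y0 unitr0 in uy.
by right; split=> //; rewrite -(mulrVK uy x) -mulrA; apply: commsub_mul.
Qed.

Lemma dclass_eqMl x y z : x \is a GRing.unit ->
  dclass_eq y z -> dclass_eq (x * y) (x * z).
Proof.
move=> ux [[-> ->]|[uy uz yz]]; first by left; rewrite mulr0.
right; split; rewrite ?unitrMl //.
by rewrite invrM // mulrA -[x * y * _]mulrA; apply: commsub_conj.
Qed.

Lemma dclass_eqMr x y z : x \is a GRing.unit ->
  dclass_eq y z -> dclass_eq (y * x) (z * x).
Proof.
move=> ux [[-> ->]|[uy uz yz]]; first by left; rewrite mul0r.
right; split; rewrite ?unitrMl //.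
by rewrite invrM // mulrA mulrK.
Qed.

Lemma dclass_eqC x y : x \is a GRing.unit -> y \is a GRing.unit ->
  dclass_eq (x * y) (y * x).
Proof.
move=> ux uy; right; split; rewrite ?unitrMl //.
by rewrite invrM // mulrA; apply: commsub_comm.
Qed.

End DieudonneClasses.

(** * Dieudonne determinants through triangular matrices *)

Section DieudonneTriangular.
Variables (L : unitRingType) (divL : division_ring L).
Variable N : nat.
Implicit Types A B T U : 'M[L]_N.

Lemma mx_invertibleM A B :
  mx_invertible A -> mx_invertible B -> mx_invertible (A *m B).
Proof.
move=> [A' [AA' A'A]] [B' [BB' B'B]]; exists (B' *m A'); split.
  by rewrite mulmxA -[A *m B *m _]mulmxA BB' mulmx1.
by rewrite mulmxA -[B' *m A' *m _]mulmxA A'A mulmx1.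
Qed.

Lemma transvection_invertible (i j : 'I_N) c :
  i != j -> mx_invertible (transvection i j c : 'M[L]_N).
Proof.
move=> ij; exists (transvection i j (- c)).
by rewrite !transvectionD // addrN addNr transvection0.
Qed.

Lemma transvection_product_invertible U :
  transvection_product U -> mx_invertible U.
Proof.
elim=> [|V i j c ij _ IH]; first by exists 1%:M; rewrite mulmx1.
by apply: mx_invertibleM => //; apply: transvection_invertible.
Qed.

Lemma diag_mx_invertible (lam : 'rV[L]_N) :
  (forall i, lam 0 i \is a GRing.unit) -> mx_invertible (diag_mx lam).
Proof.
move=> ulam; exists (diag_mx (\row_i (lam 0 i)^-1)).
split; apply/matrixP=> i j; rewrite mul_diag_mx !mxE;
  case: (eqVneq i j) => [_|_]; rewrite /= ?mulr0n ?mulr0 // ?mulr1n.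
  by rewrite mulrV.
by rewrite mulVr.
Qed.

(** Column by column, [B T = 1] forces the left inverse [B] to be upper triangular too. Each
    diagonal entry of [T] then has a left inverse, so it is nonzero, hence a unit by [divL]. *)
Lemma upper_triangular_invertible T : upper_triangular T ->
  mx_invertible T -> forall i, T i i \is a GRing.unit.
Proof.
move=> T0 [B [_ BT]] i.
suff: forall k (i : 'I_N), (i < k)%N -> T i i \is a GRing.unit /\
    forall j : 'I_N, (i < j)%N -> B j i = 0 by case/(_ i.+1 i).
elim=> // k IH {}i; rewrite ltnS => ik.
(* In entry [(j, i)] of [B T] the terms [l > i] vanish by triangularity of [T], the terms [l < i] by
   induction. *)
have BTE (j : 'I_N) : (i <= j)%N -> B j i * T i i = (j == i)%:R.
  move=> ij; have := congr1 (fun M : 'M[L]_N => M j i) BT.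
  rewrite !mxE (bigD1 i) //= big1 ?addr0 // => l /negPf li.
  have [il|li'] := ltnP i l; first by rewrite T0 ?mulr0.
  have lti : (l < i)%N by rewrite ltn_neqAle li'; rewrite -val_eqE /= in li; rewrite li.
  have [_ B0] := IH l (leq_trans lti ik).
  by rewrite B0 ?mul0r // (leq_trans lti).
have uT : T i i \is a GRing.unit.
  apply: divL; apply/eqP=> Ti; have := BTE i (leqnn _).
  by rewrite Ti mulr0 eqxx => /esym/eqP; rewrite oner_eq0.
split=> // j ij; have := BTE j (ltnW ij).
have /negPf-> : j != i by rewrite neq_ltn ij orbT.
by move=> Bji; apply: (mulIr uT); rewrite Bji mul0r.
Qed.

(** Columns are treated from left to right. Once those before [j] are diagonal, adding a multiple of
    column [i] to column [j] changes only row [i], so the entries above the pivot are cleared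
    independently. *)
Lemma triangular_diagonalization T : upper_triangular T ->
  (forall i, T i i \is a GRing.unit) ->
  exists2 U, transvection_product U & T *m U = diag_mx (\row_i T i i).
Proof.
move=> T0 uT.
suff: forall k, (k <= N)%N -> exists2 U, transvection_product U &
    forall i j : 'I_N, (T *m U) i j = if (j < k)%N then T i j *+ (i == j) else T i j.
  case/(_ N (leqnn _)) => U pU UE; exists U => //.
  by apply/matrixP=> i j; rewrite UE ltn_ord !mxE; case: eqVneq => [->|].
elim=> [|k IH] kN; first by exists 1%:M; [constructor | rewrite mulmx1].
have [U pU UE] := IH (ltnW kN); pose j := Ordinal kN.
have [|V pV VE] := @transvection_product_col _ _ j
  (fun i => - ((T i i)^-1 * T i j)) [seq i : 'I_N <- enum 'I_N | (i < k)%N].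
  by rewrite mem_filter ltnn.
exists (U *m V); first exact: transvection_product_mul.
move=> i l; rewrite mulmxA VE UE ltnS.
have [->|lj] := eqVneq l j; last first.
  have lk : (l : nat) != k by apply: contra_neq lj => lk; apply: val_inj.
  by rewrite addr0 ltn_neqAle lk.
rewrite ltnn leqnn big_filter big_enum_cond /= mulr1n.
have [ik|ki] := ltnP i k.
  rewrite (bigD1 i) //= big1 => [|x /andP[xk xi]].
    rewrite addr0 UE ik eqxx mulr1n mulrN mulVKr // subrr.
    by have /negPf-> : i != j by rewrite neq_ltn ik.
  by rewrite UE xk eq_sym (negPf xi) mulr0n mul0r.
rewrite big1 ?addr0 => [|x xk].
  by have [->|ij] := eqVneq i j; rewrite // T0 //= ltn_neqAle ki andbT eq_sym;
     apply: contra_neq ij => ij; apply: val_inj.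
have /negPf ix : i != x by rewrite neq_ltn (leq_trans xk ki) orbT.
by rewrite UE xk ix mulr0n mul0r.
Qed.

Variable d : 'M[L]_N -> L.
Hypothesis dP : is_dieudonne_det d.
Hypothesis two_unit : 2%:R \is a @GRing.unit L.

(* [E = 1 + c e_ij] is conjugate to [E^2] by the diagonal matrix with a [2] in
   position [i], so its class is idempotent, hence trivial. *)
Lemma dieudonne_transvection (i j : 'I_N) c : i != j ->
  dclass_eq (d (transvection i j c)) 1.
Proof.
case: dP => _ dU dM _ ij.
set E := transvection i j c.
pose lam : 'rV[L]_N := \row_k (if k == i then 2%:R else 1).
have ulam k : lam 0 k \is a GRing.unit.
  by rewrite mxE; case: ifP; rewrite ?unitr1.
have vE : mx_invertible E by apply: transvection_invertible.
have vD := diag_mx_invertible ulam.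
have DE : diag_mx lam *m E = E *m E *m diag_mx lam.
  rewrite transvectionD //; apply/matrixP=> k l; rewrite mul_diag_mx mul_mx_diag !mxE.
  have [->|ki] := eqVneq k i; last first.
    rewrite mul1r /= !mulr0 !addr0; have [<-|_] := eqVneq k l; last by rewrite mul0r.
    by rewrite (negPf ki) mulr1.
  have [->|lj] := eqVneq l j; last first.
    rewrite /= !mulr0 !addr0; have [_|_] := eqVneq i l; last by rewrite mul0r mulr0.
    by rewrite mulr1 mul1r.
  by rewrite (negPf ij) [j == i]eq_sym (negPf ij) /= !add0r !mulr1 mulr_natl.
have uE := dU _ vE; have uD := dU _ vD.
have h : dclass_eq (d (diag_mx lam) * d E) (d (diag_mx lam) * d E * d E).
  apply: dclass_eq_trans (dclass_eq_sym (dM _ _ vD vE)) _; rewrite DE.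
  apply: dclass_eq_trans (dM _ _ (mx_invertibleM vE vE) vD) _.
  apply: dclass_eq_trans (dclass_eqMr uD (dM _ _ vE vE)) _.
  by rewrite -[X in dclass_eq _ X]mulrA; apply: dclass_eqC; rewrite ?unitrMl //.
have uDE : d (diag_mx lam) * d E \is a GRing.unit by rewrite unitrMl.
have uDEV : (d (diag_mx lam) * d E)^-1 \is a GRing.unit by rewrite unitrV.
have := dclass_eqMl uDEV h; rewrite (mulVr uDE) (mulKr uDE).
exact: dclass_eq_sym.
Qed.

Lemma dieudonne_mul_transvections A U : mx_invertible A ->
  transvection_product U -> dclass_eq (d (A *m U)) (d A).
Proof.
case: dP => _ dU dM _ vA; elim=> [|V i j c ij pV IH].
  by rewrite mulmx1; apply: dclass_eq_refl; apply: dU.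
have vAV := mx_invertibleM vA (transvection_product_invertible pV).
rewrite mulmxA; apply: dclass_eq_trans IH.
apply: dclass_eq_trans (dM _ _ vAV (transvection_invertible c ij)) _.
rewrite -[X in dclass_eq _ X]mulr1; apply: dclass_eqMl; first exact: dU.
exact: dieudonne_transvection.
Qed.

(** Two batches of transvections, from [A] to [A U] and from there to its diagonal part, preserve
    the class; the value of [d] on diagonal matrices then fixes it. *)
Lemma dieudonne_triangularization A U : mx_invertible A ->
  transvection_product U -> upper_triangular (A *m U) ->
  dclass_eq (d A) (\prod_i (A *m U) i i).
Proof.
move=> vA pU T0; case: (dP) => _ _ _ dD.
have vT := mx_invertibleM vA (transvection_product_invertible pU).
have uT := upper_triangular_invertible T0 vT.
have [V pV TV] := triangular_diagonalization T0 uT.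
apply: dclass_eq_trans (dclass_eq_sym (dieudonne_mul_transvections vA pU)) _.
apply: dclass_eq_trans (dclass_eq_sym (dieudonne_mul_transvections vT pV)) _.
rewrite TV (eq_bigr (fun i => (\row_i (A *m U) i i) 0 i)) => [|i _]; last first.
  by rewrite mxE.
by apply: dD => i; rewrite mxE.
Qed.

End DieudonneTriangular.

(** * Sums of four squares and invertibility of quaternions *)

Section FormallyReal.

(** Anisotropy of the quaternion norm form: over a field, it makes every nonzero quaternion
    invertible. *)
Definition anisotropic4 (K : comNzRingType) := forall a b c d : K,
  a ^+ 2 + b ^+ 2 + c ^+ 2 + d ^+ 2 = 0 -> [/\ a = 0, b = 0, c = 0 & d = 0].

Lemma quat_division_ring (K : fieldType) : anisotropic4 K -> division_ring (quat K).
Proof.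
move=> K4 [a b c d] nz; apply/negP => /eqP/K4[/= a0 b0 c0 d0].
by move: nz; rewrite a0 b0 c0 d0 eqxx.
Qed.

Lemma anisotropic4_real (K : realDomainType) : anisotropic4 K.
Proof.
move=> a b c d /eqP.
do !rewrite paddr_eq0 ?addr_ge0 ?sqr_ge0 // sqrf_eq0.
rewrite sqrf_eq0.
by move=> /andP[/andP[/andP[/eqP -> /eqP ->] /eqP ->] /eqP ->].
Qed.

(** An ordered domain has characteristic zero, so the naturals below [size p] are distinct roots,
    too many for a nonzero [p]. *)
Lemma poly_horner_eq0 (K : realDomainType) (p : {poly K}) :
  (forall x, p.[x] = 0) -> p = 0.
Proof.
move=> p0; apply/eqP; apply: contraT => nz.
have := max_poly_roots nz (rs := [seq i%:R | i <- iota 0 (size p)]).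
rewrite size_map size_iota ltnn; apply.
  by apply/allP=> x _; apply/rootP.
rewrite map_inj_uniq ?iota_uniq // => m n /eqP.
by rewrite eqr_nat => /eqP.
Qed.

Lemma anisotropic4_poly (K : realDomainType) : anisotropic4 {poly K}.
Proof.
move=> a b c d abcd.
have h x : [/\ a.[x] = 0, b.[x] = 0, c.[x] = 0 & d.[x] = 0].
  apply: anisotropic4_real; have := congr1 (horner^~ x) abcd.
  by rewrite !hornerE.
by split; apply: poly_horner_eq0 => x; case: (h x).
Qed.

Lemma fraction_numden (K : idomainType) (x : {fraction K}) :
  exists2 d : K, d != 0 & exists n : K, x * tofrac d = tofrac n.
Proof.
elim/quotW: x => x; exists \d_x; first exact: denom_ratioP.
exists \n_x; rewrite !piE; apply/eqmodP.
rewrite /= FracField.equivfE /FracField.mulf !numden_Ratio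
  ?mulr1 ?oner_neq0 ?denom_ratioP //.
by rewrite mulrC.
Qed.

Lemma anisotropic4_fraction (K : idomainType) :
  anisotropic4 K -> anisotropic4 {fraction K}.
Proof.
move=> K4 a b c d abcd.
have [da da0 [na ha]] := fraction_numden a.
have [db db0 [nb hb]] := fraction_numden b.
have [dc dc0 [nc hc]] := fraction_numden c.
have [dd dd0 [nd hd]] := fraction_numden d.
(* A common denominator: multiplied by [e], the four fractions come from [K], where anisotropy is
   assumed. *)
pose e : {fraction K} := tofrac (da * db * dc * dd).
have e0 : e != 0 by rewrite tofrac_eq0 !mulf_neq0.
have ea : a * e = tofrac (na * db * dc * dd) by rewrite /e !tofracM !mulrA ha.
have eb : b * e = tofrac (da * nb * dc * dd).
  by rewrite /e !tofracM -hb !mulrA [b * _]mulrC.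
have ec : c * e = tofrac (da * db * nc * dd).
  by rewrite /e !tofracM -hc !mulrA [c * _]mulrC -!mulrA [c * _]mulrCA.
have ed : d * e = tofrac (da * db * dc * nd) by rewrite /e !tofracM -hd mulrCA.
have /K4[na0 nb0 nc0 nd0] : (na * db * dc * dd) ^+ 2 + (da * nb * dc * dd) ^+ 2 +
    (da * db * nc * dd) ^+ 2 + (da * db * dc * nd) ^+ 2 = 0.
  apply/eqP; rewrite -tofrac_eq0 !tofracD !tofracXn -ea -eb -ec -ed !exprMn.
  by rewrite -!mulrDl abcd mul0r.
by split; apply: (mulIf e0); rewrite mul0r ?ea ?eb ?ec ?ed ?na0 ?nb0 ?nc0 ?nd0 tofrac0.
Qed.

End FormallyReal.

(** * The embedding of H[q] into its skew field of quotients *)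

Section Embedding.
Variable R : fieldType.

Lemma qre_is_zmod_morphism : zmod_morphism (@qre R). Proof. by case=> ????[]. Qed.
Lemma qi_is_zmod_morphism : zmod_morphism (@qi R). Proof. by case=> ????[]. Qed.
Lemma qj_is_zmod_morphism : zmod_morphism (@qj R). Proof. by case=> ????[]. Qed.
Lemma qk_is_zmod_morphism : zmod_morphism (@qk R). Proof. by case=> ????[]. Qed.
HB.instance Definition _ :=
  GRing.isZmodMorphism.Build (quat R) R (@qre R) qre_is_zmod_morphism.
HB.instance Definition _ :=
  GRing.isZmodMorphism.Build (quat R) R (@qi R) qi_is_zmod_morphism.
HB.instance Definition _ :=
  GRing.isZmodMorphism.Build (quat R) R (@qj R) qj_is_zmod_morphism.
HB.instance Definition _ :=
  GRing.isZmodMorphism.Build (quat R) R (@qk R) qk_is_zmod_morphism.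

Lemma iota_L_is_zmod_morphism : zmod_morphism (@iota_L R).
Proof. by move=> p q; rewrite /iota_L !raddfB. Qed.
HB.instance Definition _ :=
  GRing.isZmodMorphism.Build {poly quat R} (Lquot R) (@iota_L R)
    iota_L_is_zmod_morphism.

Lemma iota_L_is_monoid_morphism : monoid_morphism (@iota_L R).
Proof.
split=> [|p q].
  rewrite /iota_L -[1]/(1%:P) !map_polyC /=.
  by rewrite !tofrac0 tofrac1.
rewrite -[RHS]/(qmul _ _) /iota_L /qmul.
(* Components are compared coefficientwise: as the variable is central, the coefficients of a
   product are sums of Hamilton products. *)
rewrite -!(tofracM, tofracB, tofracD); congr Quat; congr (tofrac _);
  apply/polyP=> i; rewrite !(coefD, coefN, coef_map) /= !coefM raddf_sum /=
    -?sumrN -!big_split /=; apply: eq_bigr => j _; rewrite !coef_map /=;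
  by case: (p`_j) (q`_(i - j)) => ????[????].
Qed.
HB.instance Definition _ :=
  GRing.isMonoidMorphism.Build {poly quat R} (Lquot R) (@iota_L R)
    iota_L_is_monoid_morphism.

End Embedding.

Lemma Lquot_division_ring (R : realFieldType) : division_ring (Lquot R).
Proof.
apply: quat_division_ring; apply: anisotropic4_fraction; exact: anisotropic4_poly.
Qed.

(** This makes [2] a unit, as the conjugation in [dieudonne_transvection] requires. *)
Lemma Lquot_two_neq0 (R : realFieldType) : 2%:R != 0 :> Lquot R.
Proof.
apply/eqP => /(congr1 (@qre _)); rewrite raddfMn /=.
rewrite -tofrac1 -tofracMn => /eqP.
by rewrite tofrac_eq0 -polyC1 -polyCMn polyC_eq0 pnatr_eq0.
Qed.

(** * A determinant representative in the column span *)

Lemma prod_first_factor (T : nzRingType) N (f : 'I_N -> T) (i0 : 'I_N) :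
  i0 = 0 :> nat -> exists c, \prod_i f i = f i0 * c.
Proof.
case: N f i0 => [|N] f i0 i00; first by case: i0 i00.
rewrite big_ord_recl; have <- : i0 = ord0 by apply: val_inj.
by eexists.
Qed.

(** Ideal membership depends on the representative and not only on its class, so [p] is constructed
    together with [v]. *)
Lemma det_repr_in_column_span (R : realFieldType) N (A : 'M[{poly quat R}]_N)
    (i0 : 'I_N) : i0 = 0 :> nat ->
  exists2 p, det_repr A p &
    exists v : 'cV_N, A *m v = p *: delta_mx i0 0.
Proof.
move=> i00; have divH := quat_division_ring (@anisotropic4_real R).
have divL := @Lquot_division_ring R.
have [vA|nvA] := classic (mx_invertible (map_mx (@iota_L R) A)); last first.
  exists 0; last by exists 0; rewrite mulmx0 scale0r.
  by move=> d [d0 _ _ _]; left; rewrite rmorph0 d0.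
have [U pU T0] := upper_triangularization divH A.
set T := A *m U in T0; pose iU := map_mx (@iota_L R) U.
have iT : map_mx (@iota_L R) A *m iU = map_mx (@iota_L R) T by rewrite map_mxM.
exists (\prod_i T i i).
  move=> d dP; rewrite rmorph_prod.
  rewrite (eq_bigr (fun i => (map_mx (@iota_L R) A *m iU) i i)) => [|i _]; last first.
    by rewrite iT [RHS]mxE.
  apply: dieudonne_triangularization => //.
  - exact: divL (Lquot_two_neq0 R).
  - exact: map_transvection_product.
  by move=> i j ji; rewrite iT mxE T0 ?rmorph0.
(* The factors do not commute: [t_0] has to stand leftmost for [T e_0 c] to equal [p e_0]. *)
have [c ->] := prod_first_factor (fun i => T i i) i00.
exists (U *m (c *: delta_mx i0 0)).
rewrite mulmxA -/T; clearbody T; apply/matrixP=> i j; rewrite !mxE (bigD1 i0) //= big1.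
  rewrite !mxE !eqxx (ord1 j) eqxx andbT addr0 mulr1.
  have [->|ii0] := eqVneq i i0; first by rewrite mulr1.
  rewrite T0 ?mul0r ?mulr0 // ltn_neqAle val_eqE eq_sym ii0 /=.
  by rewrite (leq_trans _ (leq0n i)) // leqn0; apply/eqP.
by move=> k /negPf ki; rewrite !mxE ki mulr0 mulr0.
Qed.

(** * From the Sylvester matrix to the right ideal *)

Section SylvesterIdeal.
Variables (R : fieldType) (P Q : {poly {poly quat R}}).

Lemma in_rideal0 : in_rideal P Q 0.
Proof. by exists 0, 0; rewrite !mulr0 addr0. Qed.

Lemma in_ridealD F G : in_rideal P Q F -> in_rideal P Q G -> in_rideal P Q (F + G).
Proof.
move=> [r [s ->]] [r' [s' ->]]; exists (r + r'), (s + s').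
by rewrite !mulrDr addrACA.
Qed.

Variables (phi : {rmorphism {poly quat R} -> {poly {poly quat R}}}).
Variables (z : {poly {poly quat R}}) (n m : nat) (a b : nat -> {poly quat R}).
Hypothesis z_central : forall x, GRing.comm z x.
Hypothesis P_def : P = \sum_(k < n.+1) z ^+ k * phi (a k).
Hypothesis Q_def : Q = \sum_(k < m.+1) z ^+ k * phi (b k).

(** Read in powers of [z], a column moved down by [j] rows is multiplied by [z ^+ j]; [j + k < N]
    keeps it inside the matrix. *)
Lemma sum_shifted (c : nat -> {poly quat R}) N k j : (j + k < N)%N ->
  \sum_(i < N) z ^+ i * phi (if (j <= i <= j + k)%N then c (i - j)%N else 0) =
  z ^+ j * \sum_(i < k.+1) z ^+ i * phi (c i).
Proof.
move=> jkN; rewrite mulr_sumr.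
rewrite -(big_mkord xpredT (fun i =>
  z ^+ i * phi (if (j <= i <= j + k)%N then c (i - j)%N else 0))).
rewrite (@big_cat_nat _ _ _ j) //=; last by lia.
rewrite big_nat_cond big1 ?add0r => [|i]; last first.
  by case: ifP; [lia | rewrite rmorph0 mulr0].
rewrite (@big_cat_nat _ _ _ (j + k).+1) //=; [|lia].
rewrite [X in _ + X]big_nat_cond [X in _ + X]big1 ?addr0 => [|i]; last first.
  by case: ifP; [lia | rewrite rmorph0 mulr0].
rewrite -[X in index_iota X _]add0n big_addn -addnS addnC addnK big_mkord.
apply: eq_bigr => i _.
rewrite addnK leq_addl addnC leq_add2l -ltnS ltn_ord /= mulrA -exprD.
by rewrite addnC.
Qed.

(** The column is [z ^+ j * P] or [z ^+ (j - m) * Q]. As [z] is central, the power passes to the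
    right of the generator, as a right ideal demands. *)
Lemma sylvester_column_in_rideal (j : 'I_(n + m)) (u : {poly {poly quat R}}) :
  in_rideal P Q ((\sum_(i < n + m) z ^+ i * phi (sylvester n m a b i j)) * u).
Proof.
have [jm|mj] := ltnP j m.
  under eq_bigr do rewrite mxE jm.
  rewrite sum_shifted; last by lia.
  rewrite -P_def; exists (z ^+ j * u), 0.
  by rewrite mulr0 addr0 mulrA; congr (_ * _); apply/esym/commrX/commr_sym.
under eq_bigr do rewrite mxE ltnNge mj /=.
rewrite sum_shifted; last by have := ltn_ord j; lia.
rewrite -Q_def; exists 0, (z ^+ (j - m) * u).
by rewrite mulr0 add0r mulrA; congr (_ * _); apply/esym/commrX/commr_sym.
Qed.

Lemma sylvester_span_in_rideal p (i0 : 'I_(n + m)) (v : 'cV_(n + m)) :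
  i0 = 0 :> nat -> sylvester n m a b *m v = p *: delta_mx i0 0 ->
  in_rideal P Q (phi p).
Proof.
move=> i00 Sv.
have -> : phi p = \sum_j
    (\sum_(i < n + m) z ^+ i * phi (sylvester n m a b i j)) * phi (v j 0).
  (* Pairing with the row of powers of [z] returns [phi p], since row 0 carries [z ^+ 0 = 1]. *)
  have -> : phi p = \sum_(i < n + m) z ^+ i * phi ((sylvester n m a b *m v) i 0).
    rewrite Sv (bigD1 i0) //= big1 => [|i /negPf ii0].
      by rewrite addr0 !mxE !eqxx mulr1 i00 expr0 mul1r.
    by rewrite !mxE ii0 mulr0 rmorph0 mulr0.
  under [RHS]eq_bigr do rewrite mulr_suml.
  rewrite exchange_big; apply: eq_bigr => i _ /=.
  rewrite mxE rmorph_sum mulr_sumr; apply: eq_bigr => j _.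
  by rewrite rmorphM mulrA.
elim/big_ind: _ => [||j _]; [exact: in_rideal0 | exact: in_ridealD |].
exact: sylvester_column_in_rideal.
Qed.

End SylvesterIdeal.

(* The outer variable may be either [q1] or [q2]: [z] is the eliminated variable
   and [phi] embeds the polynomials in the remaining one. *)
Lemma resultant_in_rideal (R : realFieldType) (P Q : {poly {poly quat R}})
    (phi : {rmorphism {poly quat R} -> {poly {poly quat R}}})
    (z : {poly {poly quat R}}) (n m : nat) (a b : nat -> {poly quat R}) :
  (forall x, GRing.comm z x) ->
  P = \sum_(k < n.+1) z ^+ k * phi (a k) ->
  Q = \sum_(k < m.+1) z ^+ k * phi (b k) ->
  (0 < n + m)%N ->
  exists p, det_repr (sylvester n m a b) p /\ in_rideal P Q (phi p).
Proof.
move=> zC PE QE nm; pose i0 := Ordinal nm.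
have [p dp [v Sv]] :=
  det_repr_in_column_span (sylvester n m a b) (erefl : i0 = 0 :> nat).
by exists p; split=> //; apply: (sylvester_span_in_rideal zC PE QE _ Sv).
Qed.

(** * Expansions in each of the two variables *)

Lemma sum_pick (V : nmodType) (F : nat -> V) n i :
  ((n <= i)%N -> F i = 0) -> \sum_(k < n) F k *+ (i == k) = F i.
Proof.
have [ni Fi|lt_in _] := leqP n i; last first.
  rewrite (bigD1 (Ordinal lt_in)) //= eqxx big1 ?addr0 // => k.
  by rewrite -val_eqE eq_sym /= => /negPf->.
rewrite Fi // big1 // => k _.
by rewrite gtn_eqF ?mulr0n // (leq_trans (ltn_ord k)).
Qed.

Lemma q1_expansion (R : fieldType) (P : {poly {poly quat R}}) :
  P = \sum_(k < (degq1 P).+1) 'X ^+ k * (P`_k)%:P.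
Proof.
apply/polyP=> i; rewrite coef_sum.
under eq_bigr do rewrite -commr_polyXn coefCM coefXn mulr_natr.
rewrite sum_pick // => sP.
(* For [P = 0] the truncated degree still leaves one term, so only [size P <= (degq1 P).+1] holds in
   general. *)
by rewrite nth_default // (leq_trans _ sP) // leqSpred.
Qed.

Lemma size_coef_degq2 (R : fieldType) (P : {poly {poly quat R}}) (i : nat) :
  (size (P`_i)%R <= (degq2 P).+1)%N.
Proof.
have [iP|Pi] := ltnP i (size P); last by rewrite nth_default // size_poly0.
apply: leq_trans (leqSpred _).
exact: (@leq_bigmax _ (fun i : 'I_(size P) => coef_size P i) (Ordinal iP)).
Qed.

Lemma q2_expansion (R : fieldType) (P : {poly {poly quat R}}) :
  P = \sum_(k < (degq2 P).+1) 'X%:P ^+ k * of_q1 (ptilde P k).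
Proof.
apply/polyP=> i; rewrite coef_sum; apply/polyP=> j; rewrite coef_sum.
(* The exponent of [q2] selects the term [k = j]; the truncation of [ptilde] at [size P] drops only
   zero coefficients. *)
have E k : ('X%:P ^+ k * of_q1 (ptilde P k))`_i`_j = (P`_i)`_k *+ (j == k).
  rewrite -rmorphXn coefCM coef_map /= -commr_polyXn coefCM coefXn coef_poly.
  case: ltnP => [_|Pi]; rewrite ?mulr_natr //.
  by rewrite [P`_i]nth_default // coef0 !mul0rn.
under eq_bigr do rewrite E.
rewrite sum_pick // => dj.
by rewrite nth_default // (leq_trans (size_coef_degq2 P i)).
Qed.

Theorem theorem4p5 (R : realType) (P Q : {poly {poly quat R}}) :
  ((0 < degq1 P + degq1 Q)%N ->
     exists p : {poly quat R}, det_repr (sylv_q1 P Q) p /\ in_rideal P Q (of_q2 p))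
  /\
  ((0 < degq2 P + degq2 Q)%N ->
     exists p : {poly quat R}, det_repr (sylv_q2 P Q) p /\ in_rideal P Q (of_q1 p)).
Proof.
split=> deg_gt0.
  apply: (resultant_in_rideal (phi := polyC) _
    (q1_expansion P) (q1_expansion Q) deg_gt0).
  by move=> F; apply/commr_sym/commr_polyX.
apply: (resultant_in_rideal (phi := map_poly polyC) _
  (q2_expansion P) (q2_expansion Q) deg_gt0).
(* The variable [q2], embedded as ['X%:P], is central because ['X] commutes with every coefficient
   of [F]. *)
move=> F; by apply/polyP=> i; rewrite coefCM coefMC commr_polyX.
Qed.
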